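(* Let $p(x)\in\mathbb{R}[x_0,\dots,x_n]$ be the implicit polynomial of a rational parameterization $x_i=f_i(t)/g_i(t)$, $i=0,\dots,n$. Let $S=\{s_1,\dots,s_{|S|}\}$ be the set of lattice points of a predicted polytope $Q$ for $p$. Let $M'$ be the $(|S|-1)\times|S|$ interpolation matrix built from generic distinct parameter values $\tau_1,\dots,\tau_{|S|-1}$, and let $M(x)$ be the $|S|\times|S|$ matrix obtained by appending to $M'$ the row of monomials $(x^{s_1},\dots,x^{s_{|S|}})$. If $M'$ has full rank (that is, rank $|S|-1$), then $\det M(x)$ equals $p(x)$ up to a nonzero constant factor.
   Context: Parameterization: $t=(t_1,\dots,t_n)$; $f_i,g_i\in\mathbb{R}[t]$ are nonzero polynomials for $i=0,\dots,n$; $x_i=f_i(t)/g_i(t)$. Write $x(\tau)=(f_0(\tau)/g_0(\tau),\dots,f_n(\tau)/g_n(\tau))$ whenever all $g_i(\tau)\neq0$. Implicit polynomial: the ideal of all polynomials $h\in\mathbb{R}[x_0,\dots,x_n]$ with $h(f_0/g_0,\dots,f_n/g_n)=0$ identically in $t$ is assumed to be a nonzero principal ideal. Its generator is $p(x)$ (unique up to a nonzero scalar), and $p$ is called the implicit polynomial. Polytopes: $P=N(p)\subset\mathbb{R}^{n+1}$ is the Newton polytope of $p$, i.e. the convex hull of the exponent vectors of the monomials of $p$ with nonzero coefficient. The predicted polytope $Q\subset\mathbb{R}_{\ge0}^{n+1}$ is a lattice polytope that contains $P$ and has nonempty intersection with every coordinate axis. Put $S=Q\cap\mathbb{Z}^{n+1}=\{s_1,\dots,s_{|S|}\}$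 and $m_j=x^{s_j}=x_0^{s_{j0}}\cdots x_n^{s_{jn}}$; thus $S$ is a superset of the support of $p$. Matrices: for $\tau\in\mathbb{C}^n$ with all $g_i(\tau)\ne0$, let $m_j|_{t=\tau}=\prod_{i=0}^n (f_i(\tau)/g_i(\tau))^{s_{ji}}$. Fix distinct generic values $\tau_1,\dots,\tau_{|S|-1}\in\mathbb{C}^n$ at which no $g_i$ vanishes. Then $M'$ is the $(|S|-1)\times|S|$ matrix with $(k,j)$ entry $m_j|_{t=\tau_k}$, and $M(x)$ is the $|S|\times|S|$ matrix whose first $|S|-1$ rows are those of $M'$ and whose last row is $(m_1,\dots,m_{|S|})$. ''Generic'' means: $(\tau_1,\dots,\tau_{|S|-1})$ lies in a suitable nonempty Zariski-open subset of $(\mathbb{C}^n)^{|S|-1}$ depending only on the parameterization and on $Q$. *)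

(* Defs.v *)
From HB Require Import structures.
From mathcomp Require Import all_boot all_order all_algebra.
From mathcomp Require Import fraction.
From mathcomp Require Import mpoly complex.
From mathcomp Require Import boolp classical_sets reals.

Set Implicit Arguments.
Unset Strict Implicit.
Unset Printing Implicit Defensive.

Import Order.TTheory GRing.Theory Num.Theory.

Local Open Scope ring_scope.
Local Open Scope classical_set_scope.

Section Implicitization.
Variables (R : realType) (n : nat).
Local Notation C := R[i].

(* The parameterization x_i = f_i / g_i, for i = 0, ..., n. *)
Variables (f g : 'I_n.+1 -> {mpoly R[n]}).

(* h (f_0/g_0, ..., f_n/g_n), computed in the field of fractions R(t). *)
Definition subst_param (h : {mpoly R[n.+1]}) : {fraction {mpoly R[n]}} :=
  mmap (fun c : R => tofrac c%:MP) (fun i => tofrac (f i) / tofrac (g i)) h.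

(* p generates the ideal of all h vanishing on the parameterization, which is
   thereby required to be principal and nonzero. *)
Definition implicit_polynomial (p : {mpoly R[n.+1]}) : Prop :=
  p != 0 /\
  forall h, subst_param h = 0 <-> exists q : {mpoly R[n.+1]}, h = q * p.

Definition evalC (q : {mpoly R[n]}) (tau : 'rV[C]_n) : C :=
  (map_mpoly (real_complex R) q).@[fun j => tau 0 j].

Definition monomial_at (s : 'X_{1..n.+1}) (tau : 'rV[C]_n) : C :=
  \prod_(i < n.+1) (evalC (f i) tau / evalC (g i) tau) ^+ s i.

(* Throughout, |S| = N + 1 and s lists the elements of S; row k of tau is the
   k-th interpolation point. *)
Variables (N : nat) (s : 'I_N.+1 -> 'X_{1..n.+1}) (tau : 'M[C]_(N, n)).

Definition interp_mx : 'M[C]_(N, N.+1) :=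
  \matrix_(k, j) monomial_at (s j) (row k tau).

Definition interp_mx_x : 'M[{mpoly C[n.+1]}]_N.+1 :=
  \matrix_(k, j)
    if unlift ord_max k is Some k' then (interp_mx k' j)%:MP else 'X_[s j].

End Implicitization.

Section Polytopes.
Variables (R : realType) (d : nat).

Definition conv_hull (V : seq 'rV[R]_d) : set 'rV[R]_d :=
  [set x | exists w : 'I_(size V) -> R,
    [/\ forall i, 0 <= w i, \sum_i w i = 1 & x = \sum_i w i *: V`_i]].

Definition expvec (m : 'X_{1..d}) : 'rV[R]_d := \row_i (m i)%:R.

Definition newton_polytope (p : {mpoly R[d]}) : set 'rV[R]_d :=
  conv_hull [seq expvec m | m <- msupp p].

Definition lattice_polytope (Q : set 'rV[R]_d) : Prop :=
  exists V : seq 'rV[int]_d,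
    Q = conv_hull [seq map_mx intr v | v <- V].

Definition predicted_polytope (p : {mpoly R[d]}) (Q : set 'rV[R]_d) : Prop :=
  [/\ lattice_polytope Q,
      forall x, Q x -> forall i, 0 <= x 0 i,
      newton_polytope p `<=` Q &
      forall i, exists a : R, Q (a *: delta_mx 0 i)].

(* s lists the elements of the intersection of Q with the integer lattice
   without repetition; they are recorded as multi-indices since Q lies in the
   nonnegative orthant. *)
Definition lists_lattice_points (Q : set 'rV[R]_d) (N : nat)
    (s : 'I_N -> 'X_{1..d}) : Prop :=
  injective s /\
  Q `&` [set x | forall i, x 0 i \is a Num.int] = range (fun j => expvec (s j)).

End Polytopes.

(* U is Zariski-open in the space (C^n)^N of N-tuples of points of C^n, a tuple
   being encoded as the matrix of its rows: U is the complement of the set of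
   common zeros of a set A of polynomials in the N * n coordinates. *)
Definition zariski_open (C : fieldType) (N n : nat) (U : set 'M[C]_(N, n))
    : Prop :=
  exists A : set {mpoly C[N * n]},
    U = [set tau | exists2 q, A q & q.@[fun k => mxvec tau 0 k] != 0].

(* Main.v *)
Require Import Defs.
From HB Require Import structures.
From mathcomp Require Import all_boot all_order all_algebra.
From mathcomp Require Import fraction.
From mathcomp Require Import mpoly complex.
From mathcomp Require Import boolp classical_sets reals.

(** The Zariski-open set can be taken to be the whole space: the rank
hypothesis already carries all the genericity that the argument needs.

Expanding [\det M(x)] along its last row writes it as [\sum_j v_j x^(s_j)],
where [v] is the vector of signed maximal minors of [M']
([det_append_row]).  Replacing the last row by a copy of a row of [M'] shows
that [M' v = 0] ([mul_signed_minors]); if [M'] has full rank, then it can be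
completed to an invertible matrix, so [v != 0] ([signed_minors_neq0]).

On the other hand, the support of [p] is contained in [S]
([msupp_lattice_points]), so that [p = \sum_j a_j x^(s_j)] for a nonzero
vector [a].  Since [p] vanishes identically on the parameterization, clearing
denominators shows that it vanishes at each point [x(tau_k)]
([mmap_frac_specialize]), that is, [M' a = 0].  The kernel of [M'] is a line
([ker_full_rank_line]), which contains both [v] and [a]; hence [v = c a] with [c != 0]. *)

Set Implicit Arguments.
Unset Strict Implicit.
Unset Printing Implicit Defensive.

Import Order.TTheory GRing.Theory Num.Theory.

Local Open Scope ring_scope.
Local Open Scope classical_set_scope.

(** The matrix obtained from [B] by appending a last row with entries [w]. *)
Definition append_row (T : Type) (N : nat) (B : 'M[T]_(N, N.+1))
    (w : 'I_N.+1 -> T) : 'M[T]_N.+1 :=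
  \matrix_(k, j) if unlift ord_max k is Some k' then B k' j else w j.

(** The maximal minors of an [N] by [N.+1] matrix, with the signs of the
cofactors along an appended last row. *)
Definition signed_minor (T : comNzRingType) (N : nat) (B : 'M[T]_(N, N.+1))
    (j : 'I_N.+1) : T :=
  (-1) ^+ (N + j) * \det (col' j B).

Lemma det_append_row (T : comNzRingType) (N : nat) (B : 'M[T]_(N, N.+1)) w :
  \det (append_row B w) = \sum_j w j * signed_minor B j.
Proof.
rewrite (expand_det_row _ ord_max); apply: eq_bigr => j _.
rewrite mxE unlift_none; congr (_ * (_ * \det _)).
by apply/matrixP => k i; rewrite !mxE liftK.
Qed.

Lemma signed_minor_map (T T' : comNzRingType) (h : {rmorphism T -> T'})
    (N : nat) (B : 'M[T]_(N, N.+1)) j :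
  signed_minor (map_mx h B) j = h (signed_minor B j).
Proof.
by rewrite /signed_minor rmorphM rmorphXn rmorphN1 -map_col' det_map_mx.
Qed.

Lemma mul_signed_minors (T : comNzRingType) (N : nat) (B : 'M[T]_(N, N.+1)) k :
  \sum_j B k j * signed_minor B j = 0.
Proof.
rewrite -det_append_row.
apply: (determinant_alternate (i1 := ord_max) (i2 := lift ord_max k)).
  exact: neq_lift.
by move=> j; rewrite !mxE unlift_none liftK.
Qed.

Lemma signed_minors_neq0 (F : fieldType) (N : nat) (B : 'M[F]_(N, N.+1)) :
  \rank B = N -> exists j, signed_minor B j != 0.
Proof.
move=> rB.
(* Some coordinate vector lies outside the row space of B, and appending it
   to B gives an invertible matrix. *)
have [i0 wB] : exists i : 'I_N.+1, ~~ (row i (1%:M : 'M[F]_N.+1) <= B)%MS.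
  apply/existsP; rewrite -negb_forall; apply/negP => /forallP/row_subP /mxrankS.
  by rewrite mxrank1 rB ltnn.
set w := row i0 _ in wB; pose A := append_row B (fun j => w 0 j).
have BA : (B <= A)%MS.
  apply/row_subP => k.
  suff -> : row k B = row (lift ord_max k) A by exact: row_sub.
  by apply/rowP => j; rewrite !mxE liftK.
have wA : (w <= A)%MS.
  suff -> : w = row ord_max A by exact: row_sub.
  by apply/rowP => j; rewrite !mxE unlift_none.
have rA : (N < \rank A)%N.
  rewrite -[X in (X < _)%N]rB; apply: rank_ltmx.
  by rewrite /ltmx BA; apply: contra wB => /(submx_trans wA).
have : A \in unitmx by rewrite -row_free_unit /row_free eqn_leq rank_leq_row.
rewrite unitmxE unitfE det_append_row => detA.
apply/existsP; apply: contraNT detA; rewrite negb_exists => /forallP v0.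
apply/eqP; rewrite big1 // => j _; move: (v0 j); rewrite negbK => /eqP ->.
by rewrite mulr0.
Qed.

(** A kernel vector of an [N] by [N.+1] matrix of full rank is a multiple of
any nonzero one. *)
Lemma ker_full_rank_line (F : fieldType) (N : nat) (B : 'M[F]_(N, N.+1))
    (u v : 'I_N.+1 -> F) :
    \rank B = N ->
    (forall k, \sum_j B k j * u j = 0) -> (forall k, \sum_j B k j * v j = 0) ->
    (exists j, u j != 0) ->
  exists c, forall j, v j = c * u j.
Proof.
move=> rB Bu Bv [j0 u_j0].
have inker (x : 'I_N.+1 -> F) : (forall k, \sum_j B k j * x j = 0) ->
    ((\row_j x j) <= kermx B^T)%MS.
  move=> Bx; apply/sub_kermxP/rowP => k; rewrite !mxE -[RHS](Bx k).
  by apply: eq_bigr => j _; rewrite !mxE mulrC.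
have u0 : \row_j u j != 0.
  by apply: contraNneq u_j0 => /rowP/(_ j0); rewrite !mxE => ->.
have kerE : (kermx B^T <= \row_j u j)%MS.
  have := mxrank_leqif_sup (inker _ Bu).
  by case=> _ <-; rewrite mxrank_ker mxrank_tr rB subSnn rank_rV u0.
have /sub_rVP[c /rowP vE] := submx_trans (inker _ Bv) kerE.
by exists c => j; have := vE j; rewrite !mxE.
Qed.

(** Common denominator for the values of [h] at the fractions [f i / g i]:
one element of [T] represents them under every morphism from [T] to a field
that kills no denominator. *)
Lemma mmap_clear_denominators (R : nzRingType) (T : comNzRingType)
    (phi : {rmorphism R -> T}) (d : nat) (f g : 'I_d -> T) (h : {mpoly R[d]}) :
  exists H : T, exists D : nat,
    forall (L : fieldType) (psi : {rmorphism T -> L}),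
      (forall i, psi (g i) != 0) ->
      psi H = (\prod_i psi (g i) ^+ D) *
              mmap (fun c => psi (phi c)) (fun i => psi (f i) / psi (g i)) h.
Proof.
pose D := msize h.
exists (\sum_(m <- msupp h)
  phi h@_m * \prod_i (f i ^+ m i * g i ^+ (D - m i))), D => L psi g0.
rewrite rmorph_sum /mmap mulr_sumr; apply: eq_big_seq => m hm.
rewrite rmorphM /= mulrCA; congr (_ * _).
rewrite rmorph_prod /mmap1 -big_split /=; apply: eq_bigr => i _.
have mD : (m i <= D)%N.
  apply: leq_trans (ltnW (msize_mdeg_lt hm)).
  by rewrite mdegE (bigD1 i) //= leq_addr.
rewrite rmorphM !rmorphXn /= expr_div_n -{2}(subnK mD) exprD.
by rewrite [RHS]mulrCA -mulrA mulfV ?mulr1 // expf_neq0.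
Qed.

(** A polynomial that vanishes at a tuple of formal fractions vanishes at each
of their specializations. *)
Lemma mmap_frac_specialize (R : nzRingType) (T : idomainType)
    (phi : {rmorphism R -> T}) (L : fieldType) (psi : {rmorphism T -> L})
    (d : nat) (f g : 'I_d -> T) (h : {mpoly R[d]}) :
    (forall i, psi (g i) != 0) ->
    mmap (fun c => tofrac (phi c)) (fun i => tofrac (f i) / tofrac (g i)) h = 0 ->
  mmap (fun c => psi (phi c)) (fun i => psi (f i) / psi (g i)) h = 0.
Proof.
move=> psig h0.
have [H [D HE]] := mmap_clear_denominators phi f g h.
have g0 i : tofrac (g i) != 0.
  by rewrite tofrac_eq0; apply: contraNneq (psig i) => ->; rewrite rmorph0.
have /eqP := HE _ (@tofrac T) g0.
rewrite h0 mulr0 tofrac_eq0 => /eqP H0.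
have /esym/eqP := HE _ psi psig; rewrite H0 rmorph0 mulf_eq0 => /orP[|/eqP //].
by rewrite prodf_seq_eq0 => /hasP[i _ /=]; rewrite expf_eq0 (negPf (psig i)) andbF.
Qed.

Lemma implicit_polynomial_eval (R : realType) (n : nat)
    (f g : 'I_n.+1 -> {mpoly R[n]}) (p : {mpoly R[n.+1]}) (tau : 'rV[R[i]]_n) :
    (forall i, evalC (g i) tau != 0) -> subst_param f g p = 0 ->
  (map_mpoly (real_complex R) p).@[fun i => evalC (f i) tau / evalC (g i) tau]
    = 0.
Proof.
move=> g0 p0.
pose psi : {rmorphism {mpoly R[n]} -> R[i]} :=
  (meval (fun j => tau 0 j) \o map_mpoly (real_complex R))%FUN.
rewrite -[RHS](@mmap_frac_specialize _ _ (@mpolyC n R) _ psi _ f g p g0 p0).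
rewrite {1}/map_mpoly /mmap raddf_sum /=; apply: eq_bigr => m _.
by rewrite mevalM map_mpolyC !mevalC mmap1_id mevalX.
Qed.

Lemma expvec_inj (R : realType) (d : nat) : injective (@expvec R d).
Proof.
move=> m m' /rowP mE; apply/mnmP => i.
by have := mE i; rewrite !mxE => /eqP; rewrite eqr_nat => /eqP.
Qed.

Lemma msupp_lattice_points (R : realType) (d N : nat) (p : {mpoly R[d]})
    (Q : set 'rV[R]_d) (s : 'I_N -> 'X_{1..d}) (m : 'X_{1..d}) :
    predicted_polytope p Q -> lists_lattice_points Q s -> m \in msupp p ->
  exists j, m = s j.
Proof.
move=> [_ _ PQ _] [_ QE] mp.
have : (Q `&` [set x | forall i, x 0 i \is a Num.int]) (expvec R m).
  split; last by move=> i; rewrite mxE; exact: intr_nat.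
  apply: PQ; pose V := [seq expvec R m' | m' <- msupp p].
  have mV : expvec R m \in V by exact: map_f.
  have iV : (index (expvec R m) V < size V)%N by rewrite index_mem.
  exists (fun i => (i == Ordinal iV)%:R); split=> [i||].
  - exact: ler0n.
  - by rewrite (bigD1 (Ordinal iV)) //= eqxx big1 ?addr0 // => i /negPf->.
  rewrite (bigD1 (Ordinal iV)) //= eqxx scale1r big1 ?addr0 ?nth_index //.
  by move=> i /negPf->; rewrite scale0r.
by rewrite QE => -[j _ /expvec_inj <-]; exists j.
Qed.

Lemma mpoly_sum_over_list (R : nzRingType) (d N : nat) (p : {mpoly R[d]})
    (s : 'I_N -> 'X_{1..d}) :
    injective s -> (forall m, m \in msupp p -> exists j, m = s j) ->
  p = \sum_j p@_(s j) *: 'X_[s j].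
Proof.
move=> s_inj ps; apply/mpolyP => m; rewrite raddf_sum /=.
under eq_bigr => j _ do rewrite mcoeffZ mcoeffX.
case: (boolP (m \in msupp p)) => [/ps[j ->]|mp].
  rewrite (bigD1 j) //= eqxx mulr1 big1 ?addr0 // => i ij.
  by rewrite (inj_eq s_inj) (negPf ij) mulr0.
rewrite (memN_msupp_eq0 mp) big1 // => j _.
by case: eqP => [->|_]; rewrite ?mulr0 // memN_msupp_eq0 ?mul0r.
Qed.

Theorem lemma8 (R : realType) (n : nat) (f g : 'I_n.+1 -> {mpoly R[n]})
    (f_neq0 : forall i, f i != 0) (g_neq0 : forall i, g i != 0)
    (Q : set 'rV[R]_n.+1) (N : nat) :
  exists U : set 'M[R[i]]_(N, n),
    [/\ zariski_open U, U !=set0 &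
      forall (p : {mpoly R[n.+1]}) (s : 'I_N.+1 -> 'X_{1..n.+1})
             (tau : 'M[R[i]]_(N, n)),
        implicit_polynomial f g p ->
        predicted_polytope p Q ->
        lists_lattice_points Q s ->
        U tau ->
        injective (fun k => row k tau) ->
        (forall i k, evalC (g i) (row k tau) != 0) ->
        \rank (interp_mx f g s tau) = N ->
        exists2 c : R[i], c != 0 &
          \det (interp_mx_x f g s tau) = c *: map_mpoly (real_complex R) p].
Proof.
exists setT; split.
- exists [set 1]; apply/esym/seteqP; split=> // tau _.
  by exists 1 => //; rewrite meval1 oner_neq0.
- by exists 0.
move=> p s tau [p0 pI] pQ Qs _ _ g0 rM; set M := interp_mx f g s tau in rM.
have psub : subst_param f g p = 0 by apply/pI; exists 1; rewrite mul1r.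
pose a j : R[i] := real_complex R p@_(s j).
have pE : p = \sum_j p@_(s j) *: 'X_[s j].
  apply: mpoly_sum_over_list => [|m]; first exact: Qs.1.
  exact: msupp_lattice_points pQ Qs.
have pCE : map_mpoly (real_complex R) p = \sum_j a j *: 'X_[s j].
  rewrite {1}pE rmorph_sum /=; apply: eq_bigr => j _.
  by rewrite map_mpolyZ map_mpolyX.
have Ma k : \sum_j M k j * a j = 0.
  have := implicit_polynomial_eval (fun i => g0 i k) psub.
  rewrite pCE raddf_sum /= => pk; rewrite -[RHS]pk; apply: eq_bigr => j _.
  by rewrite mevalZ mevalX mulrC mxE.
have a0 : exists j, a j != 0.
  apply/existsP; apply: contraNT p0; rewrite negb_exists => /forallP a0.
  rewrite pE big1 // => j _; move: (a0 j); rewrite negbK fmorph_eq0 => /eqP->.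
  by rewrite scale0r.
have [c vE] := ker_full_rank_line rM Ma (mul_signed_minors M) a0.
exists c.
  have [j] := signed_minors_neq0 rM.
  by apply: contraNneq => c0; rewrite vE c0 mul0r.
have -> : interp_mx_x f g s tau =
    append_row (map_mx (@mpolyC n.+1 R[i]) M) (fun j => 'X_[s j]).
  by apply/matrixP => k j; rewrite !mxE; case: unlift => // k'; rewrite !mxE.
rewrite det_append_row pCE scaler_sumr; apply: eq_bigr => j _.
by rewrite signed_minor_map vE /= scalerA mulrC mul_mpolyC.
Qed.
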